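(* Let $f=\tfrac12$ and let $\psi\colon\mathbb{R}\to\mathbb{R}$ be the function that is periodic modulo $1$ and given on $[0,1)$ by $$\psi(x)=\begin{cases}6x & 0\le x<\tfrac18,\\ 2x & \tfrac18\le x\le\tfrac38,\\ 6x-2 & \tfrac38<x\le\tfrac12,\\ 2x-\tfrac12 & \tfrac12<x\le\tfrac58,\\ 2-2x & \tfrac58\le x\le\tfrac78,\\ 2x-\tfrac32 & \tfrac78\le x<1.\end{cases}$$ Then $\psi$ is a one-sided discontinuous piecewise linear function with rational breakpoints that is extreme, but is neither a weak facet nor a facet.
   Context: Fix $f=\tfrac12$. Let $\mathcal{Y}$ be the set of finite-support functions $y\colon\mathbb{R}\to\mathbb{Z}_{\ge 0}$ with $\sum_{r\in\mathbb{R}} r\,y(r)\equiv f \pmod 1$ (i.e. the difference is an integer). A function $\pi\colon\mathbb{R}\to\mathbb{R}$ is a valid function if $\pi\ge 0$ and $\sum_{r\in\mathbb{R}}\pi(r)y(r)\ge 1$ for all $y\in\mathcal{Y}$. For a valid function $\pi$, let $P(\pi)=\{\,y\in\mathcal{Y} : \sum_{r}\pi(r)y(r)=1\,\}$. A valid function $\pi$ is: - extreme if whenever $\pi=\tfrac12(\pi^1+\pi^2)$ with $\pi^1,\pi^2$ valid functions, then $\pi=\pi^1=\pi^2$; - a facet if for every valid function $\pi'$ with $P(\pi)\subseteq P(\pi')$ we have $\pi'=\pi$; - a weak facet if for every valid function $\pi'$ with $P(\pi)\subseteq P(\pi')$ we have $P(\pi)=P(\pi')$. A function is piecewise linear if there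 is a locally finite collection of closed proper intervals covering $\mathbb{R}$, any two distinct ones intersecting at most in a common endpoint, such that the function is affine on the interior of each interval; the endpoints are the breakpoints. One-sided discontinuous means that the function is discontinuous at the origin from exactly one side (here: from the left but not from the right). *)

(* Defs.v *)
From HB Require Import structures.
From mathcomp Require Import all_boot all_order all_algebra.
From mathcomp Require Import finmap.
From mathcomp Require Import all_classical all_reals all_analysis.

Set Implicit Arguments.
Unset Strict Implicit.
Unset Printing Implicit Defensive.

Import Order.TTheory GRing.Theory Num.Theory.
Import numFieldNormedType.Exports.

Local Open Scope classical_set_scope.
Local Open Scope ring_scope.

Section InfiniteGroupProblem.
Variables (R : realType) (f : R).

(* The sum ranges over the support of [y], so it is the full sum over the
   reals. *)
Definition weighted_sum (pi : R -> R) (y : {fsfun R -> nat with 0%N}) : R :=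
  \sum_(r <- finsupp y) pi r * (y r)%:R.

Definition feasible : set {fsfun R -> nat with 0%N} :=
  [set y | weighted_sum id y - f \is a Num.int].

Definition valid (pi : R -> R) : Prop :=
  (forall r, 0 <= pi r) /\ (forall y, feasible y -> 1 <= weighted_sum pi y).

Definition tight (pi : R -> R) : set {fsfun R -> nat with 0%N} :=
  [set y | feasible y /\ weighted_sum pi y = 1].

Definition extreme (pi : R -> R) : Prop :=
  valid pi /\
  forall pi1 pi2 : R -> R, valid pi1 -> valid pi2 ->
    pi = (fun x => 2^-1 * (pi1 x + pi2 x)) -> pi = pi1 /\ pi = pi2.

Definition facet (pi : R -> R) : Prop :=
  valid pi /\
  forall pi' : R -> R, valid pi' -> tight pi `<=` tight pi' -> pi' = pi.

Definition weak_facet (pi : R -> R) : Prop :=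
  valid pi /\
  forall pi' : R -> R, valid pi' -> tight pi `<=` tight pi' ->
    tight pi = tight pi'.

End InfiniteGroupProblem.

Section PiecewiseLinear.
Variable R : realType.

(* Closed intervals, bounded or not, that are neither empty nor a point. *)
Definition closed_proper_interval (I : set R) : Prop :=
  [/\ is_interval I, closed I & exists x y, [/\ I x, I y & x < y]].

(* For a closed proper interval these are exactly its (finite) endpoints. *)
Definition endpoints (I : set R) : set R := I `\` I°.

Definition locally_finite_family (C : set (set R)) : Prop :=
  forall x : R, exists2 U, nbhs x U &
    finite_set [set I | C I /\ I `&` U !=set0].

Definition affine_on (D : set R) (g : R -> R) : Prop :=
  exists a b : R, forall x, D x -> g x = a * x + b.

Definition linear_pieces (C : set (set R)) (g : R -> R) : Prop :=
  [/\ forall I, C I -> closed_proper_interval I,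
      locally_finite_family C,
      \bigcup_(I in C) I = setT,
      forall I J, C I -> C J -> I <> J -> I `&` J !=set0 ->
        exists2 e, (endpoints I `&` endpoints J) e & I `&` J = [set e] &
      forall I, C I -> affine_on I° g].

Definition breakpoints (C : set (set R)) : set R :=
  \bigcup_(I in C) endpoints I.

Definition piecewise_linear_rational_breakpoints (g : R -> R) : Prop :=
  exists2 C, linear_pieces C g &
    forall x, breakpoints C x -> exists q : rat, x = ratr q.

(* Discontinuous at the origin from the left but not from the right. *)
Definition one_sided_discontinuous (g : R -> R) : Prop :=
  ~ (g x @[x --> 0^'-] --> g 0) /\ (g x @[x --> 0^'+] --> g 0).

Definition psi (x : R) : R :=
  let t := x - (Num.floor x)%:~R in
  if t < 1 / 8 then 6 * t
  else if t <= 3 / 8 then 2 * t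
  else if t <= 1 / 2 then 6 * t - 2
  else if t <= 5 / 8 then 2 * t - 1 / 2
  else if t <= 7 / 8 then 2 - 2 * t
  else 2 * t - 3 / 2.

End PiecewiseLinear.

(* Main.v *)
Require Import Defs.
From mathcomp Require Import all_boot all_order all_algebra.
From mathcomp Require Import finmap.
From mathcomp Require Import all_classical all_reals all_analysis.
From mathcomp Require Import zify ring lra.

(** Throughout, the gap of a function [g] at [(x, y)] is
    [g x + g y - g (x + y)]; additivity at [(x, y)] means that it vanishes.

    The function [psi] is nonnegative, periodic, subadditive and satisfies
    [psi x + psi (1/2 - x) = 1].  For such a function a feasible solution is
    tight exactly when every partial sum of its points is formed additively, so
    the tight solutions are governed by the pairs at which the function is
    additive.  Write A, B, C, D, E, F for the six successive pieces of [psi] on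
    [0, 1).  The pieces D = (1/2, 5/8) and F = (7/8, 1) take part in no
    additivity relation beyond those forced by symmetry and by [psi 0 = 0], but
    they do take part in a limit one: for [x] in [1/8, 1/4) and small
    [d > 0], the gap at [(x, 3/8 + d)] is [4 * d], which is not zero but tends
    to zero with [d].  Extremality and the failure to be a facet both come
    from this difference.

    Extremality sees the limit relations.  If [psi] is the half-sum of two valid
    functions, their gaps are nonnegative and average to the gap of [psi], so
    each is between 0 and twice the gap of [psi] ([half_gap]).  Exact additivity
    and Cauchy's functional equation on an interval
    ([bounded_additive_linear]) then make each summand linear on A, B, E, and by
    symmetry affine on C, with only the slope on A unknown; letting [d] tend to
    0 determines the summand on (1/2, 5/8] in terms of that slope, and the point
    5/8, which also belongs to E, fixes the slope to be 6 ([half_eq_psi]).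

    Tightness does not see them.  Replacing [psi] on D and F by other affine
    pieces gives a function [chi] which is again valid and is additive wherever
    [psi] is ([feasible_triple]), hence is tight wherever [psi] is
    ([tight_subset]); but it is also additive at new pairs, and
    9/16 + 7/8 + 1/16 is tight for [chi] and not for [psi].  So [psi] is not a
    weak facet, and a fortiori not a facet. *)

Set Implicit Arguments.
Unset Strict Implicit.
Unset Printing Implicit Defensive.

Import Order.TTheory GRing.Theory Num.Theory.
Import numFieldNormedType.Exports.

Local Open Scope classical_set_scope.
Local Open Scope ring_scope.

(** * Feasible solutions as lists of points *)

Section Multisets.
Variable R : realType.
Implicit Types (g : R -> R) (s : seq R).

(** Sums over a finitely supported multiplicity function become sums over the
    list of points it counts, on which one can argue by induction. *)
Definition multiset_of s : {fsfun R -> nat with 0%N} :=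
  [fsfun r in [fset r | r in s]%fset => count_mem r s].

Lemma multiset_ofE s r : multiset_of s r = count_mem r s.
Proof.
rewrite fsfunE in_fset /=; case: ifP => // /negbT /count_memPn -> //.
Qed.

Lemma weighted_sum_multiset_of g s :
  weighted_sum g (multiset_of s) = \sum_(r <- s) g r.
Proof.
rewrite -(@big_undup_iterop_count _ _ _ _ s xpredT) /weighted_sum.
rewrite (perm_big (undup s)) /=.
  apply: eq_bigr => r _.
  by rewrite multiset_ofE mulr_natr Monoid.iteropE iter_addr addr0.
apply: uniq_perm; rewrite ?undup_uniq ?fset_uniq //.
move=> r; rewrite mem_finsupp multiset_ofE mem_undup.
by rewrite -[_ == _]negbK -lt0n -has_count has_pred1 negbK.
Qed.

Definition points_of (y : {fsfun R -> nat with 0%N}) : seq R :=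
  flatten [seq nseq (y r) r | r <- finsupp y].

Lemma weighted_sum_points_of g y :
  weighted_sum g y = \sum_(r <- points_of y) g r.
Proof.
rewrite big_flatten big_map; apply: eq_bigr => r _.
by rewrite big_nseq iter_addr addr0 mulr_natr.
Qed.

Section Feasible.
Variable f : R.
Implicit Types (h : R -> R).

Lemma feasible_points_of y :
  feasible f y -> \sum_(r <- points_of y) r - f \is a Num.int.
Proof. by rewrite /feasible /= (weighted_sum_points_of id). Qed.

Lemma valid_seq g s : valid f g ->
  \sum_(r <- s) r - f \is a Num.int -> 1 <= \sum_(r <- s) g r.
Proof.
move=> [_ vg] fs; rewrite -weighted_sum_multiset_of; apply: vg.
by rewrite /feasible /= (weighted_sum_multiset_of id).
Qed.

Lemma tight_multiset_of g s : tight f g (multiset_of s) <->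
  \sum_(r <- s) r - f \is a Num.int /\ \sum_(r <- s) g r = 1.
Proof.
rewrite /tight /feasible /= (weighted_sum_multiset_of id).
by rewrite weighted_sum_multiset_of.
Qed.

(** * Gomory-Johnson functions *)

(** These conditions characterize the minimal valid functions (Gomory and
    Johnson); only their sufficiency for validity is proved here. *)
Record minimal g : Prop := Minimal {
  minimal_ge0 : forall x, 0 <= g x;
  minimal0 : g 0 = 0;
  minimal_periodic : forall x y, x - y \is a Num.int -> g x = g y;
  minimal_subadditive : forall x y, g (x + y) <= g x + g y;
  minimal_symmetric : forall x, g x + g (f - x) = 1 }.

Lemma subadditive_sum g s : minimal g ->
  g (\sum_(r <- s) r) <= \sum_(r <- s) g r.
Proof.
move=> mg; elim: s => [|r s IH]; first by rewrite !big_nil (minimal0 mg).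
rewrite !big_cons; apply: le_trans (minimal_subadditive mg _ _) _.
by rewrite lerD2l.
Qed.

Lemma minimal_f g : minimal g -> g f = 1.
Proof.
by move=> mg; have := minimal_symmetric mg 0; rewrite (minimal0 mg) add0r subr0.
Qed.

Lemma minimal_valid g : minimal g -> valid f g.
Proof.
move=> mg; split=> [r|y /feasible_points_of fy]; first exact: minimal_ge0.
rewrite weighted_sum_points_of -(minimal_f mg) -(minimal_periodic mg fy).
exact: subadditive_sum.
Qed.

(** The inequality [g (sum of s) <= sum of g over s] is a telescoping sum of
    gaps.  If it is an equality then every gap along [s] vanishes for [g], hence
    for [h], and the same telescoping gives equality for [h]. *)
Lemma tight_subset g h : minimal g -> minimal h ->
  (forall x y, g (x + y) = g x + g y -> h (x + y) = h x + h y) ->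
  tight f g `<=` tight f h.
Proof.
move=> mg mh add y [fy ty]; split=> //.
move: ty; rewrite !weighted_sum_points_of.
move/feasible_points_of: fy; set s := points_of y => fs ts.
suff Hs : \sum_(r <- s) g r = g (\sum_(r <- s) r) ->
          \sum_(r <- s) h r = h (\sum_(r <- s) r).
  rewrite Hs ?(minimal_periodic mh fs) ?minimal_f //.
  by rewrite ts (minimal_periodic mg fs) minimal_f.
elim: s {fs ts} => [|r s IH]; first by rewrite !big_nil (minimal0 mh).
rewrite !big_cons => E.
have le1 := minimal_subadditive mg r (\sum_(j <- s) j).
have le2 := subadditive_sum s mg.
by rewrite IH ?add //; lra.
Qed.

(** * Half-sums of valid functions *)

Section Halves.
Variables g g1 g2 : R -> R.
Hypotheses (mg : minimal g) (v1 : valid f g1) (v2 : valid f g2).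
Hypothesis gE : forall x, g x = 2^-1 * (g1 x + g2 x).

(** Both [g1] and [g2] sum to at least 1 on a feasible solution, so they both
    sum to exactly 1 where their average does. *)
Lemma half_tight s : \sum_(r <- s) r - f \is a Num.int ->
  \sum_(r <- s) g r = 1 -> \sum_(r <- s) g1 r = 1.
Proof.
move=> fs; rewrite (eq_bigr _ (fun x _ => gE x)) -big_distrr big_split /= => E.
have := valid_seq v1 fs; have := valid_seq v2 fs; lra.
Qed.

Lemma half_le x : 0 <= g1 x <= 2 * g x.
Proof. by rewrite gE; have := v1.1 x; have := v2.1 x; lra. Qed.

Lemma half_symmetric x z : x + z - f \is a Num.int -> g1 x + g1 z = 1.
Proof.
move=> fxz; have /half_tight : \sum_(r <- [:: x; z]) r - f \is a Num.int.
  by rewrite !big_cons big_nil addr0.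
rewrite !big_cons !big_nil !addr0; apply.
rewrite -(minimal_symmetric mg x); congr (_ + _); apply: minimal_periodic => //.
by have -> : z - (f - x) = x + z - f by ring.
Qed.

(** Shifting [x] by an integer keeps its pair with [f - x] feasible. *)
Lemma half_periodic x y : x - y \is a Num.int -> g1 x = g1 y.
Proof.
move=> xy; apply: (addIr (g1 (f - x))).
have [hx hy] : x + (f - x) - f = 0 /\ y + (f - x) - f = - (x - y).
  by split; ring.
by rewrite !half_symmetric ?hx ?hy ?rpredN ?rpred0.
Qed.

(** A valid function need not be subadditive; here the complement
    [f - (x + y)] turns the inequality into feasibility of a triple. *)
Lemma half_subadditive x y : g1 (x + y) <= g1 x + g1 y.
Proof.
have fxy : \sum_(r <- [:: x; y; f - (x + y)]) r - f \is a Num.int.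
  rewrite !big_cons big_nil.
  by have -> : x + (y + (f - (x + y) + 0)) - f = 0 by ring; rewrite rpred0.
have := valid_seq v1 fxy; rewrite !big_cons big_nil.
have : g1 (x + y) + g1 (f - (x + y)) = 1.
  apply: half_symmetric.
  by have -> : x + y + (f - (x + y)) - f = 0 by ring; rewrite rpred0.
lra.
Qed.

End Halves.

(** Both gaps are nonnegative and their average is the gap of [g].  The upper
    bound carries approximate additivity of [g] over to the summands, which no
    statement about tight solutions does. *)
Lemma half_gap g g1 g2 x y : minimal g -> valid f g1 -> valid f g2 ->
  (forall x, g x = 2^-1 * (g1 x + g2 x)) ->
  0 <= g1 x + g1 y - g1 (x + y) <= 2 * (g x + g y - g (x + y)).
Proof.
move=> mg v1 v2 gE.
have gE' z : g z = 2^-1 * (g2 z + g1 z) by rewrite gE addrC.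
have := half_subadditive mg v1 v2 gE x y.
have := half_subadditive mg v2 v1 gE' x y.
rewrite !gE; lra.
Qed.

End Feasible.
End Multisets.

(** * The pieces of psi and of its perturbation *)

Section Pieces.
Variable R : realType.
Implicit Types x y z t : R.

Definition fractional x : R := x - (Num.floor x)%:~R.

Lemma fractional_itv x : 0 <= fractional x < 1.
Proof. by have := floor_itv x; rewrite /fractional intrD; lra. Qed.

Lemma fractional_eq x y : x - y \is a Num.int -> fractional x = fractional y.
Proof.
move=> /intrP[m xy]; have {xy} -> : x = y + m%:~R by lra.
rewrite /fractional; have -> : Num.floor (y + m%:~R) = Num.floor y + m.
  by rewrite real_floorDrz ?num_real ?intr_int ?intrKfloor.
by rewrite intrD; ring.
Qed.

Lemma fractional_id t : 0 <= t < 1 -> fractional t = t.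
Proof.
by move=> t01; rewrite /fractional (@floor_def _ _ 0) ?subr0 // add0r.
Qed.

Lemma fractional_sub_int x : x - fractional x \is a Num.int.
Proof. by rewrite /fractional opprB addrCA subrr addr0 intr_int. Qed.

Lemma int_range (a : R) (n : nat) : a \is a Num.int -> -1 < a -> a < n%:R ->
  exists2 k : nat, (k < n)%N & a = k%:R.
Proof.
move=> /intrP[[k|k] ->]; rewrite ?NegzE ?mulrNz -pmulrn => lo hi.
  by exists k => //; rewrite -(ltr_nat R).
by move: lo; rewrite ltrN2 ltrn1.
Qed.

(** On (1/2, 5/8), subadditivity against the point 7/8 requires
    [chi u + 1/4 >= chi (u - 1/8) = 6 * u - 11/4], that is [chi u >= 6 * u - 3],
    and against the point 1/8 it requires
    [chi u + 1/4 >= chi (u + 1/8) = 7/4 - 2 * u], that is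
    [chi u >= 3/2 - 2 * u].  The values chosen are the least that satisfy both;
    symmetry then dictates those on (7/8, 1). *)
Definition chi t : R :=
  let u := fractional t in
  if (1 / 2 < u) && (u < 5 / 8) then Num.max (3 / 2 - 2 * u) (6 * u - 3)
  else if 7 / 8 < u then Num.min (6 * u - 5) (5 / 2 - 2 * u)
  else psi u.

(** [piece t a b] lists the possible values [a] of [psi t] and [b] of [chi t]
    for [t] in [0, 1); D and F are cut at the kinks 9/16 and 15/16 of [chi]. *)
Variant piece t : R -> R -> Prop :=
| PieceA of 0 <= t < 1 / 8 : piece t (6 * t) (6 * t)
| PieceB of 1 / 8 <= t <= 3 / 8 : piece t (2 * t) (2 * t)
| PieceC of 3 / 8 < t <= 1 / 2 : piece t (6 * t - 2) (6 * t - 2)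
| PieceD1 of 1 / 2 < t < 9 / 16 : piece t (2 * t - 1 / 2) (3 / 2 - 2 * t)
| PieceD2 of 9 / 16 <= t < 5 / 8 : piece t (2 * t - 1 / 2) (6 * t - 3)
| PieceE of 5 / 8 <= t <= 7 / 8 : piece t (2 - 2 * t) (2 - 2 * t)
| PieceF1 of 7 / 8 < t < 15 / 16 : piece t (2 * t - 3 / 2) (6 * t - 5)
| PieceF2 of 15 / 16 <= t < 1 : piece t (2 * t - 3 / 2) (5 / 2 - 2 * t).

Lemma pieceP t : 0 <= t < 1 -> piece t (psi t) (chi t).
Proof.
move=> t01; rewrite /chi /psi -/(fractional t) fractional_id //.
rewrite -/(fractional t) fractional_id //.
have [t1|t1] := ltP t (1 / 8).
  by rewrite !ifF; [constructor|..]; lra.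
have [t2|t2] := leP t (3 / 8).
  by rewrite !ifF; [constructor|..]; lra.
have [t3|t3] /= := leP t (1 / 2).
  by rewrite !ifF; [constructor|..]; lra.
have [t4|t4] /= := ltP t (5 / 8).
  rewrite ifT; last lra.
  have [u|u] := ltP t (9 / 16).
    by rewrite max_l; [constructor|]; lra.
  by rewrite max_r; [constructor|]; lra.
have [t5|t5] /= := ltP (7 / 8) t.
  rewrite !ifF; [|lra..].
  have [u|u] := ltP t (15 / 16).
    by rewrite min_l; [constructor|]; lra.
  by rewrite min_r; [constructor|]; lra.
(* The pieces D and E of psi agree at their common endpoint 5/8. *)
case: ifP => t6; last by constructor; lra.
have -> : 2 * t - 1 / 2 = 2 - 2 * t by lra.
by constructor; lra.
Qed.

End Pieces.

(** * Feasible triples *)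

Section Triples.
Variable R : realType.
Implicit Types x y z : R.

(** A finite verification: on each combination of pieces the claims are linear.
    Working with three points of sum 1/2 modulo 1 instead of with
    [x], [y] and [x + y] makes the claims symmetric, so only sorted combinations
    are needed. *)
Lemma sorted_triple x y z (a b c a' b' c' : R) :
  piece x a a' -> piece y b b' -> piece z c c' -> x <= y -> y <= z ->
  x + y + z = 1 / 2 \/ x + y + z = 3 / 2 \/ x + y + z = 5 / 2 ->
  [/\ 1 <= a + b + c, 1 <= a' + b' + c' &
      a + b + c = 1 -> a' + b' + c' = 1].
Proof.
move=> px py pz xy yz.
(* Impossible combinations are discarded as early as possible: order of the
   pieces first, then the value of the sum. *)
destruct px as [Hx|Hx|Hx|Hx|Hx|Hx|Hx|Hx];
  destruct py as [Hy|Hy|Hy|Hy|Hy|Hy|Hy|Hy];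
  first [exfalso; clear -Hx Hy xy; lra | idtac].
all: destruct pz as [Hz|Hz|Hz|Hz|Hz|Hz|Hz|Hz].
all: first [exfalso; clear -Hy Hz yz; lra | idtac].
all: clear xy yz; intros [E|[E|E]].
all: first [exfalso; lra | idtac].
all: split; lra.
Qed.

Lemma psi_periodic x y : x - y \is a Num.int -> psi x = psi y.
Proof.
move=> xy.
by rewrite /psi -/(fractional x) -/(fractional y) (fractional_eq xy).
Qed.

Lemma chi_periodic x y : x - y \is a Num.int -> chi x = chi y.
Proof. by move=> xy; rewrite /chi (fractional_eq xy). Qed.

Lemma piece_fractional x : piece (fractional x) (psi x) (chi x).
Proof.
have xu := fractional_sub_int x.
rewrite (psi_periodic xu) (chi_periodic xu).
by apply: pieceP; exact: fractional_itv.
Qed.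

Lemma frac_sum2 x y : x + y - 1 / 2 \is a Num.int ->
  fractional x + fractional y = 1 / 2 \/ fractional x + fractional y = 3 / 2.
Proof.
have i := @fractional_sub_int R; move=> xy.
have : fractional x + fractional y - 1 / 2 \is a Num.int.
  have -> : fractional x + fractional y - 1 / 2 =
      (x + y - 1 / 2) - ((x - fractional x) + (y - fractional y)) by ring.
  exact: rpredB xy (rpredD (i x) (i y)).
have [xi yi] := (fractional_itv x, fractional_itv y).
move=> /(@int_range _ _ 2)[||[|[|]]//] => *; lra.
Qed.

Lemma frac_sum3 x y z : x + y + z - 1 / 2 \is a Num.int ->
  fractional x + fractional y + fractional z = 1 / 2 \/
  fractional x + fractional y + fractional z = 3 / 2 \/
  fractional x + fractional y + fractional z = 5 / 2.
Proof.
have i := @fractional_sub_int R; move=> xyz.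
have : fractional x + fractional y + fractional z - 1 / 2 \is a Num.int.
  have -> : fractional x + fractional y + fractional z - 1 / 2 =
      (x + y + z - 1 / 2) -
      ((x - fractional x) + (y - fractional y) + (z - fractional z)) by ring.
  exact: rpredB xyz (rpredD (rpredD (i x) (i y)) (i z)).
have [[xi yi] zi] := (fractional_itv x, fractional_itv y, fractional_itv z).
move=> /(@int_range _ _ 3)[||[|[|[|]]]//] => *; lra.
Qed.

(** The first two claims amount to subadditivity of [psi] and of [chi], the
    third to additivity of [chi] wherever [psi] is additive. *)
Lemma feasible_triple x y z : x + y + z - 1 / 2 \is a Num.int ->
  [/\ 1 <= psi x + psi y + psi z, 1 <= chi x + chi y + chi z &
      psi x + psi y + psi z = 1 -> chi x + chi y + chi z = 1].
Proof.
move=> /frac_sum3 E.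
have [[px py] pz] :=
  (piece_fractional x, piece_fractional y, piece_fractional z).
have [xy|/ltW yx] := leP (fractional x) (fractional y);
  have [yz|/ltW zy] := leP (fractional y) (fractional z);
  have [xz|/ltW zx] := leP (fractional x) (fractional z);
  first [have [|||? ? ?] := sorted_triple px py pz; [by []|by []|lra|split; lra]
        |have [|||? ? ?] := sorted_triple px pz py; [by []|by []|lra|split; lra]
        |have [|||? ? ?] := sorted_triple py px pz; [by []|by []|lra|split; lra]
        |have [|||? ? ?] := sorted_triple py pz px; [by []|by []|lra|split; lra]
        |have [|||? ? ?] := sorted_triple pz px py; [by []|by []|lra|split; lra]
        |have [|||? ? ?] := sorted_triple pz py px;
           [by []|by []|lra|split; lra]].
Qed.

Lemma complementary x y : x + y - 1 / 2 \is a Num.int ->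
  psi x + psi y = 1 /\ chi x + chi y = 1.
Proof.
move=> /frac_sum2.
destruct (piece_fractional x); destruct (piece_fractional y);
  (intros [E|E]; first [exfalso; lra | split; lra]).
Qed.

(** With [z = f - (x + y)], symmetry gives [g z = 1 - g (x + y)]. *)
Lemma minimal_of_triples (f : R) (g : R -> R) :
  (forall x, 0 <= g x) -> g 0 = 0 ->
  (forall x y, x - y \is a Num.int -> g x = g y) ->
  (forall x, g x + g (f - x) = 1) ->
  (forall x y z, x + y + z - f \is a Num.int -> 1 <= g x + g y + g z) ->
  minimal f g.
Proof.
move=> g_ge0 g0 g_periodic g_sym g_triple; split=> // x y.
have := g_sym (x + y).
have : 1 <= g x + g y + g (f - (x + y)).
  by apply: g_triple; rewrite subrKC subrr rpred0.
lra.
Qed.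

(** * psi is valid and not a weak facet *)

Lemma psi_minimal : minimal (1 / 2) (@psi R).
Proof.
apply: minimal_of_triples.
- by move=> x; case: (piece_fractional x); lra.
- by rewrite /psi floor0 subr0 ifT ?mulr0 //; lra.
- exact: psi_periodic.
- by move=> x; apply: (complementary _).1; rewrite subrKC subrr rpred0.
- by move=> x y z /feasible_triple[].
Qed.

Lemma chi_minimal : minimal (1 / 2) (@chi R).
Proof.
apply: minimal_of_triples.
- by move=> x; case: (piece_fractional x); lra.
- by rewrite /chi fractional_id ?(minimal0 psi_minimal) ?ifF //; lra.
- exact: chi_periodic.
- by move=> x; apply: (complementary _).2; rewrite subrKC subrr rpred0.
- by move=> x y z /feasible_triple[].
Qed.

Lemma additive_psi_chi x y :
  psi (x + y) = psi x + psi y -> chi (x + y) = chi x + chi y.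
Proof.
have xyz : x + y + (1 / 2 - (x + y)) - 1 / 2 \is a Num.int.
  by rewrite subrKC subrr rpred0.
have [_ _] := feasible_triple xyz.
have := minimal_symmetric psi_minimal (x + y).
have := minimal_symmetric chi_minimal (x + y).
by move=> hc hp ht E; have := ht _; rewrite -E => /(_ hp); lra.
Qed.

Lemma psi_not_weak_facet : ~ weak_facet (1 / 2) (@psi R).
Proof.
move=> [_ /(_ (@chi R) (minimal_valid chi_minimal))].
move=> /(_ (tight_subset psi_minimal chi_minimal additive_psi_chi)) E.
(* 9/16 is the kink of chi in D, and the triple 9/16, 7/8, 1/16 has sum 3/2;
   chi sums to 3/8 + 1/4 + 3/8 and psi to 5/8 + 1/4 + 3/8. *)
pose y := multiset_of [:: 9 / 16 : R; 7 / 8; 1 / 16].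
have : tight (1 / 2) (@chi R) y.
  apply/tight_multiset_of; rewrite !big_cons !big_nil; split.
    have -> : 9 / 16 + (7 / 8 + (1 / 16 + 0)) - 1 / 2 = 1 :> R by lra.
    exact: rpred1.
  by do 3 (case: (@pieceP R _ _); [lra|..|] => ?; try lra).
rewrite -E => /tight_multiset_of[_]; rewrite !big_cons !big_nil.
by do 3 (case: (@pieceP R _ _); [lra|..|] => ?; try lra).
Qed.

Lemma facet_weak_facet (f : R) (g : R -> R) : facet f g -> weak_facet f g.
Proof. by move=> [vg fg]; split=> // h vh gh; rewrite (fg h vh gh). Qed.

End Triples.

(** * Additive functions on an interval *)

Section Cauchy.
Variable R : realType.
Implicit Types (x y a L M : R) (h : R -> R).

(** Cauchy's functional equation.  Subtracting a linear function, assume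
    [h L = 0].  Then [h] vanishes at the multiples of [L / n], so the value at
    [x] is the value at some [r <= L / n], and [n] times it is [h (n * r)], which
    is bounded independently of [n]. *)
Lemma bounded_additive_linear h L M : 0 < L ->
  (forall x, 0 <= x <= L -> `|h x| <= M) ->
  (forall x y, 0 <= x -> 0 <= y -> x + y <= L -> h (x + y) = h x + h y) ->
  forall x, 0 <= x <= L -> h x = h L / L * x.
Proof.
move=> L0 hM hD x /andP[x0 xL]; pose k y := h y - h L / L * y.
have kD y z : 0 <= y -> 0 <= z -> y + z <= L -> k (y + z) = k y + k z.
  by move=> y0 z0 yz; rewrite /k hD //; ring.
have kL : k L = 0 by rewrite /k divfK ?subrr // gt_eqF.
have k0 : k 0 = 0 by have := kD 0 0; rewrite addr0 => /(_ _ _ _); lra.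
have kM y : 0 <= y <= L -> `|k y| <= M + `|h L|.
  move=> /andP[y0 yL]; apply: le_trans (ler_normB _ _) _.
  apply: lerD; first by rewrite hM ?y0.
  have yL1 : `|y / L| <= 1.
    by rewrite ger0_norm ?divr_ge0 ?(ltW L0) // ler_pdivrMr // mul1r.
  by rewrite -mulrA [L^-1 * y]mulrC normrM ler_piMr.
have kn n y : 0 <= y -> n%:R * y <= L -> k (n%:R * y) = n%:R * k y.
  elim: n => [|n IH] y0; first by rewrite !mul0r k0.
  rewrite -natr1 !mulrDl !mul1r => ny.
  have ny0 : 0 <= n%:R * y by rewrite mulr_ge0.
  by rewrite kD // IH //; lra.
suff : k x = 0 by rewrite /k => /subr0_eq.
apply/eqP; rewrite -normr_le0 leNgt; apply/negP => kx.
pose n := (Num.truncn ((M + `|h L|) / `|k x|)).+1.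
have : M + `|h L| < n%:R * `|k x|.
  by rewrite -ltr_pdivrMr // truncnS_gt.
apply/negP; rewrite -leNgt.
have n0 : 0 < n%:R :> R by rewrite ltr0n.
pose s := L / n%:R; have s0 : 0 < s by rewrite divr_gt0.
have ns : n%:R * s = L by rewrite mulrC divfK // gt_eqF.
have ks : k s = 0.
  have : n%:R * k s = 0 by rewrite -kn ?ns // ltW.
  by move=> /eqP; rewrite mulf_eq0 gt_eqF //= => /eqP.
have /truncn_itv : 0 <= x / s by rewrite divr_ge0 // ltW.
set m := Num.truncn _.
rewrite ler_pdivlMr // ltr_pdivrMr // -natr1 mulrDl mul1r.
move=> /andP[ms xs]; pose r := x - m%:R * s.
have [r0 rs] : 0 <= r /\ r <= s by rewrite /r; split; lra.
have ms0 : 0 <= m%:R * s by rewrite mulr_ge0 // ltW.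
have kr : k x = k r.
  have {1}-> : x = m%:R * s + r by rewrite subrKC.
  by rewrite kD ?subrKC // kn ?ks ?mulr0 ?add0r ?(le_trans ms) // ltW.
have nr : n%:R * r <= L by rewrite -ns ler_pM2l.
rewrite kr -{1}[n%:R]ger0_norm ?(ltW n0) // -normrM -(kn _ _ r0 nr).
by rewrite kM // nr mulr_ge0.
Qed.

(** The function [y |-> h (a + y) - h a] is additive on [0, a], because the sum
    [a + y + (a + z)] can also be split as [a + (a + y + z)]; so [h] is affine
    on [a, 2a]; since [h (2 * a) = 2 * h a] it is in fact linear, and the
    sums with [a] extend this to [2a, 3a]. *)
Lemma additive_triple_interval_linear h a M : 0 < a ->
  (forall x, a <= x <= 3 * a -> `|h x| <= M) ->
  (forall x y, a <= x -> a <= y -> x + y <= 3 * a -> h (x + y) = h x + h y) ->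
  forall x, a <= x <= 3 * a -> h x = h (2 * a) / (2 * a) * x.
Proof.
move=> a0 hM hD.
have ha : h (2 * a) = 2 * h a.
  by have -> : 2 * a = a + a by [ring]; rewrite hD; lra.
have lin y : a <= y <= 2 * a -> h y = h a / a * y.
  move=> ay.
  have := @bounded_additive_linear (fun y => h (a + y) - h a) a (M + M) a0
    _ _ (y - a).
  have -> : a + a = 2 * a by ring.
  rewrite subrKC ha => E; have {}E : h y - h a = (2 * h a - h a) / a * (y - a).
    apply: E; last lra.
    - move=> z za; apply: le_trans (ler_normB _ _) _.
      by apply: lerD; apply: hM; lra.
    - move=> z w z0 w0 zw; have := hD (a + z) (a + w); have := hD a (a + z + w).
      have -> : a + (a + z + w) = a + z + (a + w) by ring.
      rewrite -[a + z + w]addrA => e1 e2.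
      by have := e1 _ _ _; have := e2 _ _ _; lra.
  have -> : h y = h a + (h y - h a) by ring.
  by rewrite E; field; rewrite gt_eqF.
move=> x ax.
have -> : h (2 * a) / (2 * a) = h a / a by rewrite ha; field; rewrite gt_eqF.
have [x2|x2] := leP x (2 * a); first by rewrite lin //; lra.
have {1}-> : x = a + (x - a) by ring.
rewrite hD ?[h (x - a)]lin; try lra.
by field; rewrite gt_eqF.
Qed.

End Cauchy.

(** * Extremality *)

Section Extreme.
Variable R : realType.
Implicit Types x y t : R.

Lemma psiA t : 0 <= t < 1 / 8 -> psi t = 6 * t.
Proof. by move=> h; case: (@pieceP _ t _); lra. Qed.
Lemma psiB t : 1 / 8 <= t <= 3 / 8 -> psi t = 2 * t.
Proof. by move=> h; case: (@pieceP _ t _); lra. Qed.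
Lemma psiC t : 3 / 8 < t <= 1 / 2 -> psi t = 6 * t - 2.
Proof. by move=> h; case: (@pieceP _ t _); lra. Qed.
Lemma psiD t : 1 / 2 < t <= 5 / 8 -> psi t = 2 * t - 1 / 2.
Proof. by move=> h; case: (@pieceP _ t _); lra. Qed.
Lemma psiE t : 5 / 8 <= t <= 7 / 8 -> psi t = 2 - 2 * t.
Proof. by move=> h; case: (@pieceP _ t _); lra. Qed.

Lemma psi_opp_middle t : 1 / 8 <= t <= 3 / 8 -> psi (- t) = 2 * t.
Proof.
move=> ht; rewrite (@psi_periodic _ _ (1 - t)) ?psiE; [lra|lra|].
by have -> : - t - (1 - t) = -1 by [ring]; rewrite rpredN rpred1.
Qed.

Lemma psi_le1 x : psi x <= 1.
Proof. by case: (piece_fractional x); lra. Qed.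

Section Half.
Variables g g' : R -> R.
Hypotheses (vg : valid (1 / 2) g) (vg' : valid (1 / 2) g').
Hypothesis psiH : forall x, psi x = 2^-1 * (g x + g' x).

Let gap x y : 0 <= g x + g y - g (x + y) <= 2 * (psi x + psi y - psi (x + y)).
Proof. exact: half_gap (psi_minimal R) vg vg' psiH. Qed.

Let additive x y : psi (x + y) = psi x + psi y -> g (x + y) = g x + g y.
Proof. by have := gap x y; lra. Qed.

Let symmetric x y : x + y - 1 / 2 \is a Num.int -> g x + g y = 1.
Proof. exact: half_symmetric (psi_minimal R) vg vg' psiH _ _. Qed.

Let bounded x : `|g x| <= 2.
Proof.
by have := half_le vg vg' psiH x; have := psi_le1 x; rewrite ler_norml; lra.
Qed.

Let sym x : g x + g (1 / 2 - x) = 1.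
Proof. by apply: symmetric; rewrite subrKC subrr rpred0. Qed.

Let periodic := half_periodic (psi_minimal R) vg vg' psiH.

(** B + B lands in B when the sum is at most 3/8, which gives linearity; the
    slope comes from the point 1/4, which is its own complement. *)
Let halfB t : 1 / 8 <= t <= 3 / 8 -> g t = 2 * t.
Proof.
move=> ht; have lin := @additive_triple_interval_linear R g (1 / 8) 2 _ _ _ t.
have -> : g t = g (2 * (1 / 8)) / (2 * (1 / 8)) * t.
  apply: lin; try lra; first by move=> *; exact: bounded.
  by move=> x y hx hy hxy; apply: additive; rewrite !psiB; lra.
have := sym (2 * (1 / 8)).
have -> : 1 / 2 - 2 * (1 / 8) = 2 * (1 / 8) :> R by lra.
by move=> E; have -> : g (2 * (1 / 8)) = 1 / 2 by [lra]; field.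
Qed.

(** The piece E is the reflection of B about 0, and [psi] is additive there in
    the same way; 3/4 is its own complement modulo 1. *)
Let halfE t : 1 / 8 <= t <= 3 / 8 -> g (- t) = 2 * t.
Proof.
move=> ht.
have lin := @additive_triple_interval_linear R (g \o -%R) (1 / 8) 2 _ _ _ t.
have /= -> : (g \o -%R) t = (g \o -%R) (2 * (1 / 8)) / (2 * (1 / 8)) * t.
  apply: lin; try lra; first by move=> *; exact: bounded.
  move=> x y hx hy hxy /=; rewrite opprD; apply: additive.
  by rewrite -opprD !psi_opp_middle; lra.
have : g (- (2 * (1 / 8))) + g (- (2 * (1 / 8))) = 1.
  apply: symmetric.
  have -> : - (2 * (1 / 8)) + - (2 * (1 / 8)) - 1 / 2 = -1 :> R by lra.
  by rewrite rpredN rpred1.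
by move=> E; have -> : g (- (2 * (1 / 8))) = 1 / 2 by [lra]; field.
Qed.

(** The slope on A, still unknown; 1/16 is an arbitrary point of A. *)
Let a := 16 * g (1 / 16).

Let halfA t : 0 <= t < 1 / 8 -> g t = a * t.
Proof.
have lin L x : 0 < L < 1 / 8 -> 0 <= x <= L -> g x = g L / L * x.
  move=> L0; apply: (bounded_additive_linear (M := 2)); first lra.
    by move=> *; exact: bounded.
  by move=> y z y0 z0 yz; apply: additive; rewrite !psiA; lra.
move=> t0; have [tL|tL] := leP t (1 / 16).
  by rewrite (lin (1 / 16)) /a; [field|lra|lra].
by rewrite /a (lin t (1 / 16)); [field; rewrite gt_eqF|..]; lra.
Qed.

Let halfC t : 3 / 8 < t <= 1 / 2 -> g t = 1 - a * (1 / 2 - t).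
Proof.
by move=> ht; have := sym t; rewrite (halfA (t := 1 / 2 - t)); lra.
Qed.

(** The limit relation B + (3/8, right-hand limit) = D: the gap of [psi] at
    [(t - 3/8 - d, 3/8 + d)] is [4 * d], so the gap of [g] is at most [8 * d],
    and [g] is known at both points. *)
Let halfD_a t : 1 / 2 < t <= 5 / 8 -> g t = 2 * t + 1 / 4 - a / 8.
Proof.
move=> ht; apply/eqP; rewrite -subr_eq0 -normr_le0; apply/ler_addgt0Pr => e e0.
rewrite add0r.
(* Small enough for t - 3/8 - d to stay in B and for the error
   (a - 2) * d + 8 * d to be at most e. *)
pose d := Num.min ((t - 1 / 2) / 2) (e / (8 + `|a - 2|)).
have c0 : 0 < 8 + `|a - 2| by rewrite ltr_wpDr.
have [d0 dt de] : [/\ 0 < d, d < t - 1 / 2 & `|a - 2| * d + 8 * d <= e].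
  split.
  - by rewrite lt_min (divr_gt0 e0 c0) andbT divr_gt0; lra.
  - have : d <= (t - 1 / 2) / 2 by rewrite ge_min lexx.
    lra.
  - rewrite -mulrDl addrC mulrC -ler_pdivlMr //.
    by rewrite ge_min lexx orbT.
have := gap (t - 3 / 8 - d) (3 / 8 + d).
have -> : t - 3 / 8 - d + (3 / 8 + d) = t by ring.
clearbody d.
rewrite (psiD ht) (@psiB (t - 3 / 8 - d)) ?(@psiC (3 / 8 + d))
  ?(@halfB (t - 3 / 8 - d)) ?(@halfC (3 / 8 + d)); try lra.
have := ler_norm ((a - 2) * d); have := ler_norm (- ((a - 2) * d)).
rewrite normrN normrM (gtr0_norm d0) ler_norml; nra.
Qed.

(** The right endpoint 5/8 of D is, modulo 1, the opposite of 3/8. *)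
Let a6 : a = 6.
Proof.
have := @halfD_a (5 / 8).
have -> : g (5 / 8) = 2 * (3 / 8).
  rewrite -halfE; last lra.
  apply: periodic.
  by have -> : 5 / 8 - - (3 / 8) = 1 :> R by [lra]; rewrite rpred1.
lra.
Qed.

Lemma half_eq_psi x : psi x = g x.
Proof.
have := fractional_sub_int x; set t := fractional x => xt.
rewrite (psi_periodic xt) (periodic xt).
have t01 : 0 <= t < 1 by exact: fractional_itv.
have [h|h] := ltP t (1 / 8); first by rewrite psiA ?halfA ?a6; lra.
have [h2|h2] := leP t (3 / 8); first by rewrite psiB ?halfB; lra.
have [h3|h3] := leP t (1 / 2); first by rewrite psiC ?halfC ?a6; lra.
have [h4|h4] := leP t (5 / 8); first by rewrite psiD ?halfD_a ?a6; lra.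
have [h5|h5] := leP t (7 / 8).
  have -> : g t = g (- (1 - t)).
    by apply: periodic; rewrite opprK addrC subrK rpred1.
  by rewrite psiE ?halfE; lra.
(* On F, pass to the complement 3/2 - t, which lies in D. *)
have tt : t + (3 / 2 - t) - 1 / 2 \is a Num.int.
  by have -> : t + (3 / 2 - t) - 1 / 2 = 1 by [lra]; rewrite rpred1.
have := symmetric tt; have [] := complementary tt.
by rewrite (@psiD (3 / 2 - t)) ?(@halfD_a (3 / 2 - t)) ?a6; lra.
Qed.

End Half.

Lemma psi_extreme : extreme (1 / 2) (@psi R).
Proof.
split; first exact/minimal_valid/psi_minimal.
move=> g1 g2 v1 v2 psi_half.
have E x : psi x = 2^-1 * (g1 x + g2 x) by rewrite {1}psi_half.
have E' x : psi x = 2^-1 * (g2 x + g1 x) by rewrite E addrC.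
split; apply/funext => x; first exact: half_eq_psi v1 v2 E x.
exact: half_eq_psi v2 v1 E' x.
Qed.

End Extreme.

(** * Discontinuity and breakpoints *)

Section Shape.
Variable R : realType.
Implicit Types x y t : R.

Lemma psi_one_sided_discontinuous : one_sided_discontinuous (@psi R).
Proof.
have psi0 : psi (0 : R) = 0 := minimal0 (psi_minimal R).
split; rewrite psi0.
  move=> /cvgrPdist_lt /(_ (1 / 4)) /(_ _)[|e /= e0 he]; first lra.
  (* psi is at least 1/4 on [-1/16, 0). *)
  pose x : R := - Num.min (e / 2) (1 / 16).
  have x0 : x < 0 by rewrite oppr_lt0 lt_min divr_gt0 //; lra.
  have x16 : - (1 / 16) <= x by rewrite lerN2 ge_min lexx orbT.
  have xe : - x <= e / 2 by rewrite opprK ge_min lexx.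
  have := he x; rewrite /= sub0r normrN (ltr0_norm x0) => /(_ _ x0).
  rewrite (@psi_periodic _ x (x + 1)); last first.
    by have -> : x - (x + 1) = -1 by [ring]; rewrite rpredN rpred1.
  rewrite sub0r normrN; case: (@pieceP _ (x + 1) _); rewrite ?ger0_norm; lra.
apply/cvgrPdist_lt => e e0.
near=> x.
have x0 : 0 < x by near: x; exact: nbhs_right_gt.
have x8 : x < 1 / 8 by near: x; apply: nbhs_right_lt; lra.
have xe : x < e / 6 by near: x; apply: nbhs_right_lt; rewrite divr_gt0.
by rewrite psiA ?sub0r ?normrN ?ger0_norm; lra.
Unshelve. all: by end_near.
Qed.

(** All breakpoints of [psi] are multiples of 1/8, so the uniform subdivision
    serves as the family of pieces. *)
Definition eighth (k : int) : set R := `[k%:~R / 8, (k + 1)%:~R / 8].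

Lemma eighthE k x : eighth k x <-> k%:~R <= 8 * x <= k%:~R + 1.
Proof. by rewrite /eighth /= in_itv /= intrD; split; lra. Qed.

Lemma interior_eighth k x : (eighth k)° x <-> k%:~R < 8 * x < k%:~R + 1.
Proof. by rewrite /eighth interior_itv /= in_itv /= intrD; split; lra. Qed.

Lemma endpoints_eighth k x :
  endpoints (eighth k) x <-> 8 * x = k%:~R \/ 8 * x = k%:~R + 1.
Proof.
split=> [[/eighthE kx /interior_eighth/negP nx]|kx].
  move: nx; rewrite negb_and -!leNgt => /orP[]; lra.
split; first by apply/eighthE; lra.
by move=> /interior_eighth; lra.
Qed.

Lemma meeting_eighths (k l : int) x : eighth k x -> eighth l x ->
  [\/ k = l, l = k + 1 | k = l + 1].
Proof.
move=> /eighthE kx /eighthE lx.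
have kl1 : (k - l)%:~R <= 1%:~R :> R by rewrite rmorphB /=; lra.
have lk1 : (l - k)%:~R <= 1%:~R :> R by rewrite rmorphB /=; lra.
move: kl1 lk1; rewrite !ler_int => kl lk.
have [|] : k - l = 0 \/ k - l = 1 \/ k - l = -1 by lia.
  by constructor 1; lia.
by case; [constructor 3|constructor 2]; lia.
Qed.

Lemma affine_psi_eighth k : affine_on (eighth k)° (@psi R).
Proof.
pose m := (k %/ 8)%Z; pose j := (k %% 8)%Z.
have km : k = m * 8 + j by rewrite /m /j -divz_eq.
suff [a [b jab]] : exists a b : R, forall t,
    j%:~R < 8 * t < j%:~R + 1 -> psi t = a * t + b.
  exists a, (b - a * m%:~R) => x /interior_eighth.
  rewrite {1 2}km intrD intrM => kx.
  rewrite (@psi_periodic _ x (x - m%:~R)).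
    by rewrite jab; [ring|lra].
  by rewrite opprB addrC subrK intr_int.
have j0 : 0 <= j by rewrite modz_ge0.
have j8 : j < 8 by rewrite (@ltz_pmod k 8).
have {km} : j = 0 \/ j = 1 \/ j = 2 \/ j = 3 \/
            j = 4 \/ j = 5 \/ j = 6 \/ j = 7.
  by lia.
case=> [->|[->|[->|[->|[->|[->|[->|->]]]]]]].
- by exists 6, 0 => t jt; case: (@pieceP _ t _); lra.
- by exists 2, 0 => t jt; case: (@pieceP _ t _); lra.
- by exists 2, 0 => t jt; case: (@pieceP _ t _); lra.
- by exists 6, (- 2) => t jt; case: (@pieceP _ t _); lra.
- by exists 2, (- (1 / 2)) => t jt; case: (@pieceP _ t _); lra.
- by exists (- 2), 2 => t jt; case: (@pieceP _ t _); lra.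
- by exists (- 2), 2 => t jt; case: (@pieceP _ t _); lra.
- by exists 2, (- (3 / 2)) => t jt; case: (@pieceP _ t _); lra.
Qed.

Lemma psi_piecewise_linear : piecewise_linear_rational_breakpoints (@psi R).
Proof.
exists (range eighth); last first.
  move=> x [_ [k _ <-]] /endpoints_eighth [kx|kx].
    exists (k%:~R / 8); rewrite fmorph_div /= ratr_int rmorph_nat; lra.
  exists ((k + 1)%:~R / 8).
  by rewrite fmorph_div /= ratr_int rmorph_nat intrD; lra.
split.
- move=> _ [k _ <-]; split.
  + exact: interval_is_interval.
  + exact: interval_closed.
  + exists (k%:~R / 8), (k%:~R / 8 + 1 / 8).
    by split; [apply/eighthE|apply/eighthE|]; lra.
- move=> x; exists (ball x (1 / 8)); first by apply: nbhsx_ballx; lra.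
  pose n := Num.floor (8 * x).
  (* Only the eighths numbered from n - 3 to n + 3 can meet the ball. *)
  have fin := finite_image (fun i : nat => eighth (n - 3 + i%:Z)) (finite_II 7).
  apply: sub_finite_set fin => _ [[k _ <-]] [y [/eighthE ky]].
  rewrite /ball /= ltr_norml => xy.
  have := floor_itv (8 * x); rewrite -/n intrD => nx.
  have : (n - 3)%:~R <= k%:~R :> R by rewrite rmorphB /=; lra.
  have : k%:~R <= (n + 3)%:~R :> R by rewrite rmorphD /=; lra.
  rewrite !ler_int => k1 k2; exists `|(k - (n - 3))%R|%N.
    by rewrite /=; lia.
  by congr eighth; lia.
- apply/seteqP; split => // x _; exists (eighth (Num.floor (8 * x))).
    by exists (Num.floor (8 * x)).
  by apply/eighthE; have := floor_itv (8 * x); rewrite intrD; lra.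
- move=> _ _ [k _ <-] [l _ <-] kl [x [kx lx]].
  have : l = k + 1 \/ k = l + 1.
    have [E|?|?] := meeting_eighths kx lx; [|by left|by right].
    by case: kl; rewrite E.
  move=> {x kx lx} E.
  wlog {E} -> : k l kl / l = k + 1.
    move=> W; case: E => E; first by apply: W.
    rewrite setIC [eighth k `&` _]setIC; apply: W => //.
    by apply: nesym.
  exists ((k%:~R + 1) / 8).
    by split; apply/endpoints_eighth; rewrite ?intrD; [right|left]; lra.
  apply/seteqP; split => [x [/eighthE kx /eighthE]|_ ->].
    by rewrite intrD /=; lra.
  by split; apply/eighthE; rewrite ?intrD; lra.
- by move=> _ [k _ <-]; exact: affine_psi_eighth.
Qed.

End Shape.

Theorem theorem6p1 (R : realType) :
  one_sided_discontinuous (@psi R) /\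
  piecewise_linear_rational_breakpoints (@psi R) /\
  extreme (1 / 2)%R (@psi R) /\
  ~ weak_facet (1 / 2)%R (@psi R) /\
  ~ facet (1 / 2)%R (@psi R).
Proof.
split; first exact: psi_one_sided_discontinuous.
split; first exact: psi_piecewise_linear.
split; first exact: psi_extreme.
split; first exact: psi_not_weak_facet.
by move=> /facet_weak_facet; exact: psi_not_weak_facet.
Qed.
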